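(* Let $m=m(n)\le n$ be integers with $m=n-O(\sqrt n)$ as $n\to\infty$, and let $$\mu:=\frac{\binom{n-m}{2}\binom{n}{3}}{\binom{\binom{n}{2}}{2}}.$$ Then, as $n\to\infty$, $$|s(n,m)|=\binom{\binom{n}{2}}{n-m}e^{-\mu}\left(1+O\!\left(\frac{n-m}{n}\right)\right),$$ $$S(n,m)=\binom{\binom{n}{2}}{n-m}e^{-2\mu}\left(1+O\!\left(\frac{n-m}{n}\right)\right).$$ In particular, let $t>0$ and $0\le a\le\frac12$ be fixed. Then for $m=n-t\,n^a$, as $n\to\infty$ (through values for which $t\,n^a$ is an integer), $$|s(n,m)|\sim\binom{\binom{n}{2}}{t\,n^a}e^{-\frac23t^2n^{2a-1}}\sim\frac{1}{\sqrt{2\pi\,t^5\,n^a}}\,e^{t\,n^a\left((2-a)\ln n+1-\ln 2\right)-\frac23t^2n^{2a-1}},$$ $$S(n,m)\sim\binom{\binom{n}{2}}{t\,n^a}e^{-\frac43t^2n^{2a-1}}\sim\frac{1}{\sqrt{2\pi\,t^5\,n^a}}\,e^{t\,n^a\left((2-a)\ln n+1-\ln 2\right)-\frac43t^2n^{2a-1}}.$$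
   Context: $s(n,m)$ and $S(n,m)$ denote the (signed) Stirling numbers of the first kind and the Stirling numbers of the second kind, defined by $\sum_{m=0}^n s(n,m)x^m=(x)_n$ and $\sum_{m=0}^n S(n,m)(x)_m=x^n$, where $(x)_n=x(x-1)\cdots(x-n+1)$ is the falling factorial. The notation $f(n)\sim g(n)$ means $f(n)/g(n)\to1$.
   Formalization: In the last equivalence of both final displays, t^5 under the root is replaced by t^{2tn^a+1}, and that equivalence is claimed only for 0<a≤1/2; as printed it fails for t≠1 and for a=0. *)

(* Defs.v *)
From HB Require Import structures.
From mathcomp Require Import all_boot all_order all_algebra.
From mathcomp Require Import all_classical all_reals all_analysis.

Set Implicit Arguments.
Unset Strict Implicit.
Unset Printing Implicit Defensive.

Import Order.TTheory GRing.Theory Num.Theory.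
Import numFieldNormedType.Exports.

Local Open Scope classical_set_scope.
Local Open Scope ring_scope.

(* (x)_n as a polynomial in x. *)
Definition falling (n : nat) : {poly int} := \prod_(i < n) ('X - i%:R%:P).

(* The defining identities only constrain the entries with m <= n. There they
   have a unique solution: see stirling1_ex, stirling1_uniq, stirling2_ex and
   stirling2_uniq below. *)
Definition is_stirling1 (s : nat -> nat -> int) : Prop :=
  forall n, \sum_(m < n.+1) s n m *: 'X^m = falling n.

Definition is_stirling2 (S : nat -> nat -> int) : Prop :=
  forall n, \sum_(m < n.+1) S n m *: falling m = 'X^n.

(* f ~ g along F, meaning f / g --> 1. *)
Definition asymp_eq (R : realType) (F : set_system nat) (f g : nat -> R) : Prop :=
  (fun n => f n / g n) @ F --> (1 : R).

(* f = g (1 + O(e)) as n --> oo. *)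
Definition eq_up_to_bigO (R : realType) (f g e : nat -> R) : Prop :=
  exists h : nat -> R,
    h =O_\oo e /\ (\forall n \near \oo, f n = g n * (1 + h n)).

Definition mu (R : realType) (n m : nat) : R :=
  ('C(n - m, 2) * 'C(n, 3))%:R / 'C('C(n, 2), 2)%:R.

(* C(C(n,2), t n^a) e^{- c t^2 n^{2a-1}}, where n - m n = t n^a. *)
Definition binomial_form (R : realType) (c t a : R) (m : nat -> nat) (n : nat) : R :=
  'C('C(n, 2), n - m n)%:R * expR (- (c * t ^+ 2 * n%:R `^ (2 * a - 1))).

(* With k = t n^a this is (n^2 / 2)^k / (sqrt (2 pi k) (k / e)^k) times
   e^{- c t^2 n^{2a-1}}; the factor t^k of k^k = t^k n^{a k} is absorbed in the
   square root, whence the power t^{2k+1}. A constant power of t there, as in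
   1 / sqrt (2 pi t^5 n^a), is not equivalent to binomial_form for t <> 1: the
   quotient is of exact order t^k. Since it comes from Stirling's formula for
   k!, the equivalence also needs k --> oo, that is 0 < a. *)
Definition explicit_form (R : realType) (c t a : R) (n : nat) : R :=
  1 / Num.sqrt (2 * pi * t `^ (2 * (t * n%:R `^ a) + 1) * n%:R `^ a)
    * expR (t * n%:R `^ a * ((2 - a) * ln n%:R + 1 - ln 2)
            - c * t ^+ 2 * n%:R `^ (2 * a - 1)).

Lemma fallingS n : falling n.+1 = falling n * ('X - n%:R%:P).
Proof. by rewrite /falling big_ord_recr. Qed.

Lemma falling_monic n : falling n \is monic.
Proof. by apply: monic_prod => i _; apply: monicXsubC. Qed.

Lemma size_falling n : size (falling n) = n.+1.
Proof. by rewrite /falling size_prod_XsubC /index_enum -enumT size_enum_ord. Qed.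

Lemma stirling1_ex : exists s, is_stirling1 s.
Proof.
exists (fun n m => (falling n)`_m) => n.
by rewrite -[RHS]coefK poly_def size_falling.
Qed.

Lemma stirling1_uniq s s' n m : is_stirling1 s -> is_stirling1 s' ->
  (m <= n)%N -> s n m = s' n m.
Proof.
move=> hs hs' le_mn.
have coefs u : is_stirling1 u -> u n m = (falling n)`_m.
  by move=> <-; rewrite -(poly_def n.+1 (u n)) coef_poly ltnS le_mn.
by rewrite !coefs.
Qed.

Lemma stirling2_ex : exists S, is_stirling2 S.
Proof.
pose fix S (n m : nat) {struct n} : int := match n, m with
  | 0%N, 0%N => 1
  | 0%N, _.+1 => 0
  | _.+1, 0%N => 0
  | n'.+1, m'.+1 => S n' m' + m'.+1%:R * S n' m'.+1
  end.
have S0 n m : (n < m)%N -> S n m = 0.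
  elim: n m => [|n IH] [|m] //= lt_nm.
  by rewrite !IH ?mulr0 ?addr0 // ltnW.
exists S; elim=> [|n IH].
  by rewrite big_ord1 /= /falling big_ord0 scale1r expr0.
rewrite exprSr -IH mulr_suml big_ord_recl /= scale0r add0r.
under eq_bigr do rewrite /bump /= add1n scalerDl.
rewrite big_split /=.
have -> : \sum_(i < n.+1) (i.+1%:R * S n i.+1) *: falling i.+1
        = \sum_(i < n.+1) (i%:R * S n i) *: falling i.
  rewrite big_ord_recr /= S0 // mulr0 scale0r addr0.
  by rewrite [RHS]big_ord_recl /= mul0r scale0r add0r.
rewrite -big_split /=; apply: eq_bigr => i _.
rewrite fallingS -scalerAl mulrBr scalerBr mulrC [_ * S _ _]mulrC.
by rewrite -scalerA [_ * _%:P]mulrC mul_polyC subrK mulrC.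
Qed.

Lemma stirling2_uniq S S' n m : is_stirling2 S -> is_stirling2 S' ->
  (m <= n)%N -> S n m = S' n m.
Proof.
move=> hS hS' le_mn; apply/eqP; rewrite -subr_eq0; apply/eqP.
have free k (c : nat -> int) : \sum_(i < k) c i *: falling i = 0 ->
    forall i, (i < k)%N -> c i = 0.
  elim: k => // k IH; rewrite big_ord_recr /= => sum0.
  have ck0 : c k = 0.
    have := congr1 (fun p : {poly int} => p`_k) sum0.
    rewrite coefD coef_sum coefZ coef0 big1 => [|i _].
      have := monicP (falling_monic k).
      by rewrite lead_coefE size_falling /= => ->; rewrite mulr1 add0r.
    by rewrite coefZ [X in _ * X]nth_default ?mulr0 ?size_falling.
  move: sum0; rewrite ck0 scale0r addr0 => /IH {}IH i.
  by rewrite ltnS leq_eqVlt => /orP[/eqP->|/IH].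
apply: (free n.+1 (fun i => S n i - S' n i)); last by rewrite ltnS.
under eq_bigr do rewrite scalerBl.
by rewrite sumrB hS hS' subrr.
Qed.

(* Main.v *)
(* With k = n - m and N = C(n,2), the numbers |s(n,m)| and S(n,m) are the
   elementary symmetric e_k(0,...,n-1) and the complete homogeneous
   h_k(1,...,m).  The first terms of Newton's identities, truncated with a
   definite sign, are proved by induction from the Stirling recurrences and
   determine (i+1) e_{i+1} / (N e_i) = 1 - 4i/(3n) + O(1/n), and similarly
   (i+1) h_{i+1} / (N h_i) = 1 - 2k/n + 4i/(3n) + O(1/n), for i < k = O(sqrt n).
   The successive quotients of C(N,i) exp(-E_i) have the same expansion for a
   quadratic E_i with E_k = mu, resp. 2 mu (mu is exactly 4 C(k,2) / (3(n+1))),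
   so multiplying k quotients gives a relative error O(k/n).  The explicit form
   is Stirling's formula for k!, whose constant comes from the Wallis product. *)

Require Import Defs.
From HB Require Import structures.
From mathcomp Require Import all_boot all_order all_algebra.
From mathcomp Require Import all_classical all_reals all_analysis.
From mathcomp Require Import ring lra.

Set Implicit Arguments.
Unset Strict Implicit.
Unset Printing Implicit Defensive.

Import Order.TTheory GRing.Theory Num.Theory.
Import numFieldNormedType.Exports.

Local Open Scope classical_set_scope.
Local Open Scope ring_scope.

(* [esym n j] is e_j(0, ..., n-1) = |s(n, n-j)|. *)
Fixpoint esym (n j : nat) : nat :=
  match n, j with
  | 0, 0 => 1
  | 0, _.+1 => 0
  | _.+1, 0 => 1
  | n'.+1, j'.+1 => esym n' j'.+1 + n' * esym n' j'
  end%N.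

Definition hsym_step (x : nat) (f : nat -> nat) : nat -> nat :=
  fix g j := if j is j'.+1 then (f j'.+1 + x * g j')%N else 1%N.

(* [hsym m j] is h_j(1, ..., m) = S(m+j, m). *)
Fixpoint hsym (m : nat) : nat -> nat :=
  if m is m'.+1 then hsym_step m'.+1 (hsym m') else fun j => (j == 0)%N.

Lemma esymn0 n : esym n 0 = 1%N. Proof. by case: n. Qed.
Lemma hsymn0 m : hsym m 0 = 1%N. Proof. by case: m. Qed.

Lemma esymS n j : esym n.+1 j.+1 = (esym n j.+1 + n * esym n j)%N.
Proof. by []. Qed.

Lemma hsymS m j : hsym m.+1 j.+1 = (hsym m j.+1 + m.+1 * hsym m.+1 j)%N.
Proof. by []. Qed.

Lemma esym_gt n j : (n < j)%N -> esym n j = 0%N.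
Proof.
elim: n j => [|n IH] [|j] // lt_nj.
by rewrite esymS !IH ?muln0 // ltnW.
Qed.

Lemma coef_falling n j : (j <= n)%N ->
  (falling n)`_(n - j) = (-1) ^+ j * (esym n j)%:R.
Proof.
elim: n j => [|n IH] [|j] //.
- by rewrite /falling big_ord0 coef1.
- by have := monicP (falling_monic n.+1); rewrite lead_coefE size_falling esymn0 mulr1 subn0.
rewrite ltnS => le_jn; rewrite fallingS mulrBr coefB coefMX coefMC subSS IH //.
rewrite esymS natrD natrM exprS.
have [lt_jn|le_nj] := ltnP j n.
  rewrite subn_eq0 leqNgt lt_jn /= -subnS IH // exprS.
  by rewrite mulrDr !mulN1r !mulNr [n%:R * _]mulrC mulrA.
have -> : j = n by apply/eqP; rewrite eqn_leq le_jn.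
by rewrite subnn (@esym_gt n n.+1) //= !add0r !mulN1r mulNr [n%:R * _]mulrC mulrA.
Qed.

Lemma stirling1_esym s n m : is_stirling1 s -> (m <= n)%N ->
  `|s n m| = (esym n (n - m))%:R.
Proof.
move=> hs le_mn.
have -> : s n m = (falling n)`_(n - (n - m)).
  by rewrite -hs -(poly_def n.+1 (s n)) subKn // coef_poly ltnS le_mn.
by rewrite coef_falling ?leq_subr // normrM normrX normrN1 expr1n mul1r normr_nat.
Qed.

Arguments hsym : simpl never.

Lemma hsym_stirling2 : is_stirling2 (fun n m => (hsym m (n - m))%:R).
Proof.
elim=> [|n IH]; first by rewrite big_ord1 /= /falling big_ord0 scale1r expr0.
rewrite exprSr -{}IH mulr_suml.
have step (i : 'I_n.+1) : (hsym i (n - i))%:R *: falling i * 'X =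
    (hsym i (n - i))%:R *: falling i.+1 + (i * hsym i (n - i))%:R *: falling i :> {poly int}.
  rewrite fallingS -!mul_polyC natrM !polyCM; ring.
under [RHS]eq_bigr do rewrite step.
rewrite big_split /= [RHS]addrC.
rewrite big_ord_recl big_ord_recr /= [in RHS]big_ord_recl [in RHS]big_ord_recr /=.
rewrite mul0n mulr0n !scale0r !add0r !subnn addrA; congr (_ + _).
  rewrite -big_split /=; apply: eq_bigr => i _.
  have lt_in := ltn_ord i.
  rewrite /bump !add1n -scalerDl; congr (_ *: _).
  rewrite (_ : n.+1 - i.+1 = (n - i.+1).+1)%N; last by rewrite subSS subnSK.
  by rewrite hsymS -natrD subnSK // addnC.
by rewrite !hsymn0.
Qed.

Lemma stirling2_hsym S n m : is_stirling2 S -> (m <= n)%N ->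
  S n m = (hsym m (n - m))%:R.
Proof. by move=> hS; apply: stirling2_uniq hsym_stirling2. Qed.

Lemma natSr (R : pzSemiRingType) n : n.+1%:R = n%:R + 1 :> R.
Proof. by rewrite natr1. Qed.

(* The previous term of a sequence, with the value 0 at index 0: the recurrences
   and inequalities below then hold without exception at small indices. *)
Definition lag (T : nmodType) (f : nat -> T) (j : nat) : T :=
  if j is j'.+1 then f j' else 0.

Lemma lag_ge0 (R : numDomainType) (f : nat -> R) j :
  (forall i, 0 <= f i) -> 0 <= lag f j.
Proof. by case: j => [|j] h /=. Qed.

Section Newton.
Variable R : realFieldType.

Definition esymR n j : R := (esym n j)%:R.
Definition hsymR m j : R := (hsym m j)%:R.

Lemma esymR_ge0 n j : 0 <= esymR n j. Proof. exact: ler0n. Qed.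
Lemma hsymR_ge0 m j : 0 <= hsymR m j. Proof. exact: ler0n. Qed.

Lemma esymRS n j : esymR n.+1 j = esymR n j + n%:R * lag (esymR n) j.
Proof.
case: j => [|j]; first by rewrite /esymR !esymn0 /= mulr0 addr0.
by rewrite /esymR esymS natrD natrM.
Qed.

Lemma lag_esymRS n j : lag (esymR n.+1) j = lag (esymR n) j + n%:R * lag (lag (esymR n)) j.
Proof. by case: j => [|j] /=; rewrite ?mulr0 ?addr0 // esymRS. Qed.

Lemma lag2_esymRS n j :
  lag (lag (esymR n.+1)) j = lag (lag (esymR n)) j + n%:R * lag (lag (lag (esymR n))) j.
Proof. by case: j => [|j] /=; rewrite ?mulr0 ?addr0 // lag_esymRS. Qed.

Let N n : R := n%:R * (n%:R - 1) / 2.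
Let p2 n : R := n%:R * (n%:R - 1) * (2 * n%:R - 1) / 6.

Lemma esym_upper1 n j : j.+1%:R * esymR n j.+1 <= N n * esymR n j.
Proof.
elim: n j => [|n IH] j; first by rewrite /N !mul0r mulr0.
have IHj := IH j.
have {}IH : j%:R * esymR n j <= N n * lag (esymR n) j.
  by case: j {IHj} => [|j] /=; rewrite ?mul0r ?mulr0.
rewrite !esymRS /=.
have ge0 : 0 <= n%:R * n%:R * lag (esymR n) j.
  by rewrite !mulr_ge0 // lag_ge0 // => i; apply: esymR_ge0.
have := ler_wpM2l (ler0n R n) IH.
move: IHj ge0; rewrite /N ?(natSr R n) ?(natSr R j).
by lra.
Qed.

Lemma esym_lower1 n j : (N n - j%:R * n%:R) * esymR n j <= j.+1%:R * esymR n j.+1.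
Proof.
elim: n j => [|n IH] j; first by rewrite /N !mul0r mulr0 subr0 mul0r mulr0.
have IHj := IH j.
have {}IH : (N n - (j%:R - 1) * n%:R) * lag (esymR n) j <= j%:R * esymR n j.
  case: j {IHj} => [|j] /=; first by rewrite mul0r mulr0.
  by rewrite -[j.+1%:R - 1]/(_) -natr1 addrK natr1.
rewrite !esymRS /=.
have ge0 : 0 <= n%:R * (j%:R * lag (esymR n) j).
  by rewrite !mulr_ge0 // lag_ge0 // => i; apply: esymR_ge0.
have ge0' : 0 <= j%:R * esymR n j by rewrite mulr_ge0.
have := ler_wpM2l (ler0n R n) IH.
move: IHj ge0 ge0'; rewrite /N ?(natSr R n) ?(natSr R j).
by lra.
Qed.

Lemma esym_lower2 n j :
  N n * esymR n j - p2 n * lag (esymR n) j <= j.+1%:R * esymR n j.+1.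
Proof.
elim: n j => [|n IH] j; first by rewrite /N /p2 !mul0r mulr0 subr0.
have IHj := IH j.
have {}IH : N n * lag (esymR n) j - p2 n * lag (lag (esymR n)) j <= j%:R * esymR n j.
  by case: j {IHj} => [|j] //=; rewrite !mulr0 subr0 mul0r.
rewrite !esymRS lag_esymRS /=.
have ge0 : 0 <= n%:R ^+ 3 * lag (lag (esymR n)) j.
  by rewrite mulr_ge0 ?exprn_ge0 // !lag_ge0 // => i; rewrite lag_ge0 // => k; apply: esymR_ge0.
have := ler_wpM2l (ler0n R n) IH.
move: IHj ge0; rewrite /N /p2 ?(natSr R n) ?(natSr R j).
by lra.
Qed.

Lemma esym_upper3 n j : j.+1%:R * esymR n j.+1 <=
  N n * esymR n j - p2 n * lag (esymR n) j + N n ^+ 2 * lag (lag (esymR n)) j.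
Proof.
elim: n j => [|n IH] j; first by rewrite /N /p2 expr2 !mul0r mulr0 subr0 add0r.
have IHj := IH j.
have {}IH : j%:R * esymR n j <= N n * lag (esymR n) j - p2 n * lag (lag (esymR n)) j
    + N n ^+ 2 * lag (lag (lag (esymR n))) j.
  by case: j {IHj} => [|j] //=; rewrite !mulr0 subr0 mul0r addr0.
rewrite !esymRS lag_esymRS lag2_esymRS /=.
have ge0 : 0 <= n%:R ^+ 4 * lag (lag (lag (esymR n))) j.
  by rewrite mulr_ge0 ?exprn_ge0 // !lag_ge0 // => i; rewrite lag_ge0 // => k; rewrite lag_ge0 // => l; apply: esymR_ge0.
have := ler_wpM2l (ler0n R n) IH.
move: IHj ge0; rewrite /N /p2 ?(natSr R n) ?(natSr R j).
by lra.
Qed.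

Lemma hsymRS m j : hsymR m.+1 j = hsymR m j + m.+1%:R * lag (hsymR m.+1) j.
Proof.
case: j => [|j]; first by rewrite /hsymR !hsymn0 /= mulr0 addr0.
by rewrite /hsymR hsymS natrD natrM.
Qed.

Let P1 m : R := m%:R * (m%:R + 1) / 2.
Let P2 m : R := m%:R * (m%:R + 1) * (2 * m%:R + 1) / 6.

Lemma hsym_lower1 m j : P1 m * hsymR m j <= j.+1%:R * hsymR m j.+1.
Proof.
elim: m j => [|m IHm] j; first by rewrite /P1 !mul0r mulr0.
elim: j => [|j IHj].
  have := IHm 0%N; rewrite ![hsymR m.+1 _]hsymRS /= mulr0 addr0 /hsymR !hsymn0 /P1.
  rewrite ?(natSr R m).
  lra.
have IH := IHm j.+1; move: IHj IH.
have eqj1 := hsymRS m j.+1; have eqj2 := hsymRS m j.+2.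
have ge0 : 0 <= m.+1%:R ^+ 2 * hsymR m.+1 j by rewrite mulr_ge0 ?exprn_ge0 ?hsymR_ge0.
rewrite /= in eqj1 eqj2 *.
rewrite [hsymR m.+1 j.+2]eqj2 => IHj.
have := ler_wpM2l (ler0n R m.+1) IHj; move: ge0; rewrite eqj1.
rewrite /P1 ?(natSr R j.+1) ?(natSr R j) ?(natSr R m).
lra.
Qed.

Lemma hsym_lower2 m j :
  P1 m * hsymR m j + P2 m * lag (hsymR m) j <= j.+1%:R * hsymR m j.+1.
Proof.
elim: m j => [|m IHm] j; first by rewrite /P1 /P2 !mul0r mulr0 addr0.
elim: j => [|j IHj].
  have := IHm 0%N; rewrite ![hsymR m.+1 _]hsymRS /= mulr0 addr0 /hsymR !hsymn0 /P1.
  rewrite ?(natSr R m).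
  lra.
have IH := IHm j.+1; move: IHj IH.
have eqj := hsymRS m j; have eqj1 := hsymRS m j.+1; have eqj2 := hsymRS m j.+2.
have ge0 : 0 <= m.+1%:R ^+ 3 * lag (hsymR m.+1) j.
  by rewrite mulr_ge0 ?exprn_ge0 ?lag_ge0 // => i; apply: hsymR_ge0.
rewrite /= in eqj1 eqj2 *.
rewrite [hsymR m.+1 j.+2]eqj2 => IHj.
have := ler_wpM2l (ler0n R m.+1) IHj; move: ge0; rewrite eqj1 eqj.
rewrite /P1 /P2 ?(natSr R j.+1) ?(natSr R j) ?(natSr R m).
lra.
Qed.

Lemma hsym_upper1 m j : j.+1%:R * hsymR m j.+1 <= (P1 m + m%:R * j%:R) * hsymR m j.
Proof.
elim: m j => [|m IHm] j; first by rewrite /P1 !mul0r mulr0 addr0 mul0r.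
elim: j => [|j IHj].
  have := IHm 0%N; rewrite ![hsymR m.+1 _]hsymRS /= mulr0 addr0 /hsymR !hsymn0 /P1.
  rewrite ?(natSr R m).
  lra.
have IH := IHm j.+1; move: IHj IH.
have eqj1 := hsymRS m j.+1; have eqj2 := hsymRS m j.+2.
have ge0 : 0 <= hsymR m j.+1 by apply: hsymR_ge0.
have ge0' : 0 <= hsymR m.+1 j by apply: hsymR_ge0.
have ge1 : 0 <= j%:R * hsymR m j.+1 by rewrite mulr_ge0.
rewrite /= in eqj1 eqj2 *.
rewrite [hsymR m.+1 j.+2]eqj2 => IHj.
have := ler_wpM2l (ler0n R m.+1) IHj; rewrite eqj1.
move: ge0 ge0' ge1.
rewrite /P1 ?(natSr R j.+1) ?(natSr R j) ?(natSr R m).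
lra.
Qed.

Lemma hsym_upper2 m j : j.+1%:R * hsymR m j.+1 <=
  P1 m * hsymR m j + (P2 m + m%:R ^+ 2 * (j%:R - 1)) * lag (hsymR m) j.
Proof.
elim: m j => [|m IHm] j.
  rewrite /P1 /P2 expr2 !mul0r mulr0 !add0r.
  by rewrite mul0r.
elim: j => [|j IHj].
  have := IHm 0%N; rewrite ![hsymR m.+1 _]hsymRS /= mulr0 addr0 /hsymR !hsymn0 /P1.
  rewrite ?(natSr R m).
  lra.
have IH := IHm j.+1; move: IHj IH.
have eqj := hsymRS m j; have eqj1 := hsymRS m j.+1; have eqj2 := hsymRS m j.+2.
have ge0 : 0 <= (2 * m%:R + 1) * (j%:R * hsymR m j).
  by rewrite !mulr_ge0 ?hsymR_ge0 // addr_ge0 // mulr_ge0.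
rewrite /= in eqj1 eqj2 *.
rewrite [hsymR m.+1 j.+2]eqj2 => IHj.
have := ler_wpM2l (ler0n R m.+1) IHj; move: ge0; rewrite eqj1 eqj.
rewrite /P1 /P2 ?(natSr R j.+1) ?(natSr R j) ?(natSr R m).
lra.
Qed.

End Newton.
Lemma ratio_compare (R : realFieldType) (f g L : nat -> R) (W eta : R) (k : nat) :
  f 0%N = g 0%N -> 0 < W -> 0 <= eta -> 8 * k%:R * eta <= 1 ->
  (forall i, 0 <= f i) -> (forall i, (i <= k)%N -> 0 < g i) ->
  (forall i, (i < k)%N -> 1 / 2 <= L i - eta) ->
  (forall i, (i < k)%N -> `|i.+1%:R * f i.+1 - W * L i * f i| <= W * eta * f i) ->
  (forall i, (i < k)%N -> `|i.+1%:R * g i.+1 - W * L i * g i| <= W * eta * g i) ->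
  `|f k - g k| <= 8 * eta * k%:R * g k.
Proof.
move=> fg0 W0 eta0 keta f0 g0 Lge fstep gstep.
suff H i : (i <= k)%N -> `|f i - g i| <= 8 * eta * i%:R * g i by exact: H.
elim: i => [_|i IH lt_ik]; first by rewrite fg0 subrr normr0 mulr0 mul0r.
have {}IH := IH (ltnW lt_ik).
have gi0 := g0 _ (ltnW lt_ik); have gS0 := g0 _ lt_ik.
have {}fstep := fstep _ lt_ik; have {}gstep := gstep _ lt_ik; have {}Lge := Lge _ lt_ik.
have i0 : 0 < i.+1%:R :> R by rewrite ltr0n.
have ieta : 8 * i%:R * eta <= 1.
  by apply: le_trans keta; rewrite ler_wpM2r // ler_wpM2l // ler_nat ltnW.
have fi2 : f i <= 2 * g i.
  move: IH; rewrite ler_norml => /andP[_].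
  have := ler_wpM2r (ltW gi0) ieta; lra.
have Wg : W * g i <= 2 * (i.+1%:R * g i.+1).
  have Wgi : 0 < W * g i by rewrite mulr_gt0.
  move: gstep; rewrite ler_norml => /andP[+ _].
  have := ler_wpM2l (ltW Wgi) Lge; lra.
have cross : `|f i.+1 * g i - f i * g i.+1| <= 4 * eta * f i * g i.+1.
  rewrite -(ler_pM2l i0) -{1}(gtr0_norm i0) -normrM.
  have -> : i.+1%:R * (f i.+1 * g i - f i * g i.+1) =
    (i.+1%:R * f i.+1 - W * L i * f i) * g i - (i.+1%:R * g i.+1 - W * L i * g i) * f i.
    by ring.
  apply: le_trans (ler_normB _ _) _.
  rewrite !normrM (gtr0_norm gi0) (ger0_norm (f0 i)).
  have := ler_wpM2r (ltW gi0) fstep; have := ler_wpM2r (f0 i) gstep.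
  have : eta * f i * (W * g i) <= eta * f i * (2 * (i.+1%:R * g i.+1)).
    by rewrite ler_wpM2l // mulr_ge0.
  lra.
rewrite -(ler_pM2l gi0) -{1}(gtr0_norm gi0) -normrM.
have -> : g i * (f i.+1 - g i.+1) =
  (f i.+1 * g i - f i * g i.+1) + g i.+1 * (f i - g i) by ring.
apply: le_trans (ler_normD _ _) _.
rewrite normrM (gtr0_norm gS0).
have := ler_wpM2l (ltW gS0) IH.
have : 4 * eta * g i.+1 * f i <= 4 * eta * g i.+1 * (2 * g i).
  by rewrite ler_wpM2l // !mulr_ge0 // ltW.
rewrite natSr; move: cross; lra.
Qed.

Lemma natr_bin2 (R : numFieldType) n : 'C(n, 2)%:R = n%:R * (n%:R - 1) / 2 :> R.
Proof.
case: n => [|n]; first by rewrite !mul0r.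
apply: (mulfI (x := 2)); first by rewrite pnatr_eq0.
rewrite -natrM mul_bin_left bin1 subn1 /= natrM (natSr R n); by field.
Qed.

Lemma natr_bin3 (R : numFieldType) n :
  'C(n, 3)%:R = n%:R * (n%:R - 1) * (n%:R - 2) / 6 :> R.
Proof.
case: n => [|[|n]]; first by rewrite !mul0r.
  by rewrite subrr mulr0 !mul0r.
have /eqP := mul_bin_left n.+2 2; rewrite -(eqr_nat R) !natrM natr_bin2 !subSS subn0.
move=> /eqP eq3; apply: (mulfI (x := 3)); first by rewrite pnatr_eq0.
rewrite eq3 (natSr R n.+1) (natSr R n); by field.
Qed.

Lemma muE (R : realType) n m : (3 <= n)%N ->
  mu R n m = 4 / 3 * 'C(n - m, 2)%:R / (n%:R + 1).
Proof.
move=> n3; rewrite /mu natrM natr_bin3 (natr_bin2 R 'C(n, 2)) (natr_bin2 R n).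
set K := 'C(n - m, 2)%:R.
have n3R : 3 <= n%:R :> R by rewrite ler_nat.
field.
have n2 : 0 < (n%:R - 2) * (n%:R + 1) :> R by rewrite mulr_gt0 //; lra.
by apply/and4P; split; apply/negP => /eqP; lra.
Qed.

Lemma expRN_le (R : realType) (z : R) : 0 <= z -> expR (- z) <= 1 - z + z ^+ 2.
Proof.
move=> z0; rewrite expRN.
have z1 : 0 < 1 + z by lra.
apply: (@le_trans _ _ (1 + z)^-1).
  by rewrite lef_pV2 ?posrE ?expR_gt0 // expR_ge1Dx.
rewrite -(ler_pM2l z1) mulfV ?gt_eqF //.
have : 0 <= z ^+ 3 by rewrite exprn_ge0.
by rewrite -subr_ge0 (_ : (1 + z) * (1 - z + z ^+ 2) - 1 = z ^+ 3) //; ring.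
Qed.

(** * Quotients of consecutive terms *)

Section Steps.
Variables (R : realType) (D : R) (n k : nat).
Hypotheses (D1 : 1 <= D) (k0 : (0 < k)%N) (kn : 256 * k%:R * D <= n%:R :> R)
  (kD : k%:R ^+ 2 <= D * n%:R :> R).

Let W : R := n%:R * (n%:R - 1) / 2.
Let eta : R := 32 * D / n%:R.

Let k1 : 1 <= k%:R :> R. Proof. by rewrite ler1n. Qed.
Let kn' : 256 * k%:R <= n%:R :> R.
Proof. by apply: le_trans kn; rewrite ler_peMr. Qed.
Let n256 : 256 <= n%:R :> R. Proof. by move: k1 kn'; lra. Qed.
Let W0 : 0 < W. Proof. by rewrite /W divr_gt0 ?mulr_gt0 //; move: n256; lra. Qed.

Let Weta : W * eta = 16 * D * (n%:R - 1).
Proof. by rewrite /W /eta; field; rewrite gt_eqF //; move: n256; lra. Qed.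

Let Dn i : (i < k)%N -> [/\ 0 <= i%:R :> R, i%:R <= k%:R - 1 :> R, i%:R ^+ 2 <= D * n%:R
  & n%:R <= D * n%:R].
Proof.
move=> lt_ik; have ik : i%:R <= k%:R - 1 :> R.
  by rewrite lerBrDr natr1 ler_nat.
split=> //; last by rewrite ler_peMl.
apply: le_trans kD; rewrite ler_sqr ?nnegrE ?ler0n //; move: ik; lra.
Qed.

Lemma esym_step i : (i < k)%N ->
  `|i.+1%:R * esymR R n i.+1 - W * (1 - 4 / 3 * i%:R / n%:R) * esymR R n i|
  <= W * eta * esymR R n i.
Proof.
move=> lt_ik; have [i0 ik iD nD] := Dn lt_ik.
have n0 : n%:R != 0 :> R by rewrite gt_eqF //; move: n256; lra.
rewrite (_ : W * (1 - _) = W - 2 / 3 * (n%:R - 1) * i%:R); last by rewrite /W; field.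
rewrite Weta; set c := esymR R n i; set c1 := lag (esymR R n) i.
set c2 := lag (lag (esymR R n)) i.
have c_ge0 : 0 <= c by apply: esymR_ge0.
have c1_ge0 : 0 <= c1 by apply: lag_ge0 => ?; apply: esymR_ge0.
have c2_ge0 : 0 <= c2 by apply: lag_ge0 => ?; apply: lag_ge0 => ?; apply: esymR_ge0.
have lo := esym_lower2 R n i; have up := esym_upper3 R n i.
have P : i%:R * c <= W * c1.
  rewrite /c /c1; case: (i) => [|j] /=; first by rewrite mul0r mulr0.
  exact: esym_upper1.
have Q : (W - (i%:R - 1) * n%:R) * c1 <= i%:R * c.
  rewrite /c /c1; case: (i) => [|j] /=; first by rewrite mul0r mulr0.
  by rewrite natSr addrK -natSr; apply: esym_lower1.
have S : (W - (i%:R - 2) * n%:R) * c2 <= (i%:R - 1) * c1.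
  rewrite /c1 /c2; case: (i) => [|[|j]] /=; rewrite ?mulr0 ?subrr ?mul0r //.
  have -> : j.+2%:R - 1 = j.+1%:R :> R by rewrite (natSr R j.+1) addrK.
  have -> : j.+2%:R - 2 = j%:R :> R by rewrite (natSr R j.+1) (natSr R j); ring.
  exact: esym_lower1.
rewrite -/c -/c1 -/c2 -/W in lo up.
rewrite (natSr R i) in lo up *; set c' := esymR R n i.+1 in lo up *.
have xc : 0 <= i%:R * c by rewrite mulr_ge0.
have nc1 : 0 <= n%:R * c1 by rewrite mulr_ge0.
have nc2 : 0 <= n%:R * c2 by rewrite mulr_ge0.
have half : 0 <= W / 2 - i%:R * n%:R.
  rewrite (_ : _ - _ = n%:R * ((n%:R - 1) / 4 - i%:R)); last by rewrite /W; field.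
  by rewrite mulr_ge0 //; move: ik kn' n256; lra.
have n4W : 0 <= 4 * W - n%:R ^+ 2.
  rewrite (_ : _ - _ = n%:R * (n%:R - 2)); last by rewrite /W; field.
  by rewrite mulr_ge0 //; move: n256; lra.
have Q2 : W / 2 * c1 <= i%:R * c by have := mulr_ge0 half c1_ge0; move: Q nc1; lra.
have S2 : W / 2 * c2 <= i%:R * c1.
  by have := mulr_ge0 half c2_ge0; move: S nc2 c1_ge0; lra.
have n12 : 0 <= (2 * n%:R - 1) / 3 :> R by move: n256; lra.
have cD : 0 <= D * (n%:R - 256) * c.
  by rewrite !mulr_ge0 //; move: D1 n256; lra.
have iDc : i%:R ^+ 2 * c <= D * n%:R * c by rewrite ler_wpM2r.
have ic : i%:R * c <= D * n%:R * c.
  by rewrite ler_wpM2r // (le_trans _ nD) //; move: ik kn' n256; lra.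
rewrite ler_norml; apply/andP; split.
  have T1 := ler_wpM2l n12 Q.
  have T2 := mulr_ge0 i0 (mulr_ge0 n4W c1_ge0).
  have T3 := ler_wpM2l i0 Q2.
  have T4 : n%:R * c1 <= n%:R * (n%:R * c1).
    by rewrite ler_peMl //; move: n256; lra.
  have T5 : 0 <= i%:R * (n%:R * c1) by rewrite mulr_ge0.
  move: lo T1 T2 T3 T4 T5 cD iDc ic xc nc1; rewrite /W; lra.
have T1 := ler_wpM2l n12 P.
have T2 := ler_wpM2l (ltW W0) S2.
have T3 := ler_wpM2l i0 Q2.
have p2W : n%:R * (n%:R - 1) * (2 * n%:R - 1) / 6 = W * ((2 * n%:R - 1) / 3) :> R.
  by rewrite /W; field.
rewrite p2W in up.
move: up T1 T2 T3 cD iDc ic xc; lra.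
Qed.
Lemma hsym_step_bound i : (i < k)%N -> (k <= n)%N ->
  `|i.+1%:R * hsymR R (n - k) i.+1
    - W * (1 - 2 * k%:R / n%:R + 4 / 3 * i%:R / n%:R) * hsymR R (n - k) i|
  <= W * eta * hsymR R (n - k) i.
Proof.
move=> lt_ik le_kn; have [i0 ik iD nD] := Dn lt_ik.
have n0 : n%:R != 0 :> R by rewrite gt_eqF //; move: n256; lra.
rewrite (_ : W * (1 - _ + _) = W - (n%:R - 1) * (k%:R - 2 / 3 * i%:R)); last first.
  by rewrite /W; field.
rewrite Weta; set m := (n - k)%N.
have mE : m%:R = n%:R - k%:R :> R by rewrite natrB.
set P1 : R := m%:R * (m%:R + 1) / 2.
set h := hsymR R m i; set h1 := lag (hsymR R m) i.
have h_ge0 : 0 <= h by apply: hsymR_ge0.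
have h1_ge0 : 0 <= h1 by apply: lag_ge0 => ?; apply: hsymR_ge0.
have lo := hsym_lower2 R m i; have up := hsym_upper2 R m i.
have P : P1 * h1 <= i%:R * h.
  rewrite /h /h1; case: (i) => [|j] /=; first by rewrite mul0r mulr0.
  exact: hsym_lower1.
have Q : i%:R * h <= (P1 + m%:R * (i%:R - 1)) * h1.
  rewrite /h /h1; case: (i) => [|j] /=; first by rewrite mul0r mulr0.
  by rewrite (natSr R j) addrK -natSr; apply: hsym_upper1.
rewrite -/h -/h1 -/P1 in lo up.
rewrite (natSr R i) in lo up *; set h' := hsymR R m i.+1 in lo up *.
have P2E : m%:R * (m%:R + 1) * (2 * m%:R + 1) / 6 = P1 * ((2 * m%:R + 1) / 3) :> R.
  by rewrite /P1; field.
rewrite P2E in lo up.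
have WP : P1 = W - (n%:R - 1) * k%:R + (n%:R - k%:R) + (k%:R ^+ 2 - k%:R) / 2.
  by rewrite /P1 /W mE; field.
have hP := congr1 (fun x => x * h) WP; rewrite /= in hP.
have m0 : 0 <= m%:R :> R by [].
have ih : 0 <= i%:R * h by rewrite mulr_ge0.
have kh : i%:R * h <= k%:R * h by rewrite ler_wpM2r //; move: ik; lra.
have khn : k%:R * h <= n%:R * h by rewrite ler_wpM2r //; move: kn' k1; lra.
have k2h : k%:R ^+ 2 * h <= D * n%:R * h by rewrite ler_wpM2r.
have nDh : n%:R * h <= D * n%:R * h by rewrite ler_wpM2r.
have i2h : i%:R ^+ 2 * h <= D * n%:R * h by rewrite ler_wpM2r.
have cD : 0 <= D * (n%:R - 256) * h.
  by rewrite !mulr_ge0 //; move: D1 n256; lra.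
have mh1 : 0 <= m%:R * h1 by rewrite mulr_ge0.
have m13 : 0 <= (2 * m%:R + 1) / 3 :> R by rewrite divr_ge0 // addr_ge0 // mulr_ge0.
rewrite ler_norml; apply/andP; split.
  have T1 := ler_wpM2l m13 Q.
  have T2 := ler_wpM2l i0 P.
  have T3 : (2 * m%:R + 1) / 3 * (m%:R * (i%:R * h1)) <= 4 / 3 * (P1 * (i%:R * h1)).
    rewrite -subr_ge0 (_ : _ - _ = m%:R / 3 * (i%:R * h1)); last by rewrite /P1; field.
    by rewrite mulr_ge0 ?divr_ge0 ?mulr_ge0.
  have T4 : 0 <= (2 * m%:R + 1) / 3 * (m%:R * h1) by rewrite mulr_ge0.
  have T5 : k%:R * i%:R * h <= k%:R ^+ 2 * h.
    by rewrite expr2 ler_wpM2r // ler_wpM2l //; move: ik; lra.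
  have T6 : m%:R * i%:R * h = n%:R * i%:R * h - k%:R * i%:R * h by rewrite mE; ring.
  move: hP lo T1 T2 T3 T4 T5 T6 cD k2h nDh i2h ih kh khn; lra.
have T1 := ler_wpM2l m13 P.
have T2 := ler_wpM2l i0 P.
have T3 : m%:R ^+ 2 * h1 * i%:R <= 2 * P1 * h1 * i%:R.
  rewrite -subr_ge0 (_ : _ - _ = m%:R * h1 * i%:R); last by rewrite /P1; field.
  by rewrite mulr_ge0.
have T4 : 0 <= m%:R ^+ 2 * h1 by rewrite mulr_ge0 ?exprn_ge0.
have T6 : m%:R * i%:R * h = n%:R * i%:R * h - k%:R * i%:R * h by rewrite mE; ring.
have T5 : 0 <= k%:R * i%:R * h by rewrite !mulr_ge0.
move: hP up T1 T2 T3 T4 T5 T6 cD k2h nDh i2h ih kh khn; lra.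
Qed.

Let kW : (k <= 'C(n, 2))%N.
Proof.
rewrite -(ler_nat R) natr_bin2 -/W.
have : 0 <= n%:R * (n%:R / 2 - 1 / 2 - 1) :> R by rewrite mulr_ge0 //; move: n256; lra.
by move: kn' k1; rewrite /W; lra.
Qed.

Let etaE : [/\ 0 <= eta, 8 * k%:R * eta <= 1 & eta <= 1 / 8].
Proof.
have n0 : 0 < n%:R :> R by move: n256; lra.
have D0 : 0 <= D by move: D1; lra.
split; first by rewrite /eta divr_ge0 // mulr_ge0.
  by rewrite /eta mulrA ler_pdivrMr // mul1r; move: kn; lra.
rewrite /eta ler_pdivrMr //; have := ler_wpM2r D0 k1; move: kn; lra.
Qed.

Lemma bin_expR_step (E : nat -> R) (i : nat) (A z : R) : (i < k)%N ->
  z = E i.+1 - E i -> 0 <= z ->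
  A - 16 * D * (n%:R - 1) <= W - i%:R - W * z ->
  W - W * z + W * z ^+ 2 <= A + 16 * D * (n%:R - 1) ->
  let g := fun j => 'C('C(n, 2), j)%:R * expR (- E j) in
  `|i.+1%:R * g i.+1 - A * g i| <= W * eta * g i.
Proof.
move=> lt_ik zE z0 lo up /=.
have le_iW : (i <= 'C(n, 2))%N by apply: leq_trans kW; apply: ltnW.
set g := 'C('C(n, 2), i)%:R * _.
have gi : 0 <= g by rewrite mulr_ge0 // expR_ge0.
have -> : i.+1%:R * ('C('C(n, 2), i.+1)%:R * expR (- E i.+1)) = (W - i%:R) * expR (- z) * g.
  rewrite /g mulrA -natrM mul_bin_left natrM natrB // natr_bin2 -/W.
  by rewrite (_ : - E i.+1 = - z + - E i) ?expRD; [ring | rewrite zE; ring].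
rewrite Weta -mulrBl normrM (ger0_norm gi) ler_wpM2r //.
have iW : i%:R <= W by rewrite /W -natr_bin2 ler_nat.
have e0 := expR_ge0 (- z).
have e1 := expR_ge1Dx (- z).
have e2 := expRN_le z0.
have iz : 0 <= i%:R * z by rewrite mulr_ge0.
have ie : 0 <= i%:R * expR (- z) by rewrite mulr_ge0.
have Wi0 : 0 <= W - i%:R by rewrite subr_ge0.
rewrite ler_norml; apply/andP; split.
  by have := ler_wpM2l Wi0 e1; move: lo iz; lra.
by have := ler_wpM2l (ltW W0) e2; move: up ie; lra.
Qed.

Lemma bin_expR_gt0 (E : nat -> R) i : (i <= k)%N ->
  0 < 'C('C(n, 2), i)%:R * expR (- E i).
Proof.
by move=> le_ik; rewrite mulr_gt0 ?expR_gt0 // ltr0n bin_gt0 (leq_trans le_ik).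
Qed.

Lemma esym_approx :
  let g := 'C('C(n, 2), k)%:R * expR (- (4 / 3 * 'C(k, 2)%:R / (n%:R + 1))) in
  `|esymR R n k - g| <= 256 * D * (k%:R / n%:R) * g.
Proof.
pose E (i : nat) : R := 2 / 3 * (i%:R * (i%:R - 1)) / (n%:R + 1).
rewrite /= (_ : 4 / 3 * 'C(k, 2)%:R / (n%:R + 1) = E k); last first.
  by rewrite /E natr_bin2; field; rewrite gt_eqF //; move: n256; lra.
have n0 : 0 < n%:R :> R by move: n256; lra.
have [eta0 keta eta8] := etaE.
rewrite (_ : 256 * D * _ = 8 * eta * k%:R); last first.
  by rewrite /eta; field; rewrite gt_eqF.
pose L (i : nat) : R := 1 - 4 / 3 * i%:R / n%:R.
apply: (@ratio_compare _ (esymR R n) (fun i => 'C('C(n, 2), i)%:R * expR (- E i)) L W) => //.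
- by rewrite /esymR esymn0 bin0 /E !mul0r mulr0 mul0r oppr0 expR0 mulr1.
- by move=> i; apply: bin_expR_gt0.
- move=> i lt_ik; have [i0 ik _ _] := Dn lt_ik.
  have : i%:R / n%:R <= 1 / 256 :> R by rewrite ler_pdivrMr //; move: ik kn'; lra.
  rewrite /L; move: eta8; lra.
- by move=> i; apply: esym_step.
move=> i lt_ik; have [i0 ik iD nD] := Dn lt_ik.
pose z : R := 4 / 3 * i%:R / (n%:R + 1).
have n1 : 0 < n%:R + 1 :> R by move: n0; lra.
have z0 : 0 <= z by rewrite /z divr_ge0 ?mulr_ge0 // ltW.
have WL : W * L i = W - 2 / 3 * (n%:R - 1) * i%:R.
  by rewrite /W /L; field; rewrite gt_eqF.
have Wz1 : W * z <= 2 / 3 * (n%:R - 1) * i%:R.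
  rewrite /W /z mulrA ler_pdivrMr // -subr_ge0.
  rewrite (_ : _ - _ = 2 / 3 * (n%:R - 1) * i%:R); last by field.
  by rewrite !mulr_ge0 //; move: n256; lra.
have Wz2 : 2 / 3 * (n%:R - 2) * i%:R <= W * z.
  rewrite /W /z mulrA ler_pdivlMr // -subr_ge0.
  rewrite (_ : _ - _ = 4 / 3 * i%:R); last by field.
  by rewrite !mulr_ge0.
have Wz3 : W * z ^+ 2 <= i%:R ^+ 2.
  have zn : z * n%:R <= 4 / 3 * i%:R.
    rewrite -[leRHS](divfK (lt0r_neq0 n1)).
    by rewrite ler_wpM2l //; lra.
  have zn0 : 0 <= z * n%:R by rewrite mulr_ge0.
  have : (z * n%:R) ^+ 2 <= (4 / 3 * i%:R) ^+ 2 by rewrite ler_sqr ?nnegrE ?mulr_ge0.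
  have : 0 <= z ^+ 2 * n%:R by rewrite mulr_ge0 ?exprn_ge0.
  have : 0 <= i%:R ^+ 2 :> R by rewrite exprn_ge0.
  by rewrite /W; lra.
have DD : 0 <= D * (n%:R - 256) by rewrite mulr_ge0 //; move: D1 n256; lra.
apply: (@bin_expR_step E i _ z) => //.
- by rewrite /E /z natSr; field; rewrite gt_eqF.
- rewrite WL; move: Wz1 DD D1 nD kn' ik i0; lra.
rewrite WL; move: Wz2 Wz3 DD D1 nD kn' ik i0 iD; lra.
Qed.

Lemma hsym_approx : (k <= n)%N ->
  let g := 'C('C(n, 2), k)%:R * expR (- (2 * (4 / 3 * 'C(k, 2)%:R / (n%:R + 1)))) in
  `|hsymR R (n - k) k - g| <= 256 * D * (k%:R / n%:R) * g.
Proof.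
move=> le_kn.
pose E (i : nat) : R :=
  (2 * (k%:R - 1) * i%:R - 2 / 3 * (i%:R * (i%:R - 1))) / (n%:R + 1).
(* C(m+1,2) / C(n,2) = 1 - 2(k-1)/n + O(1/n) gives the first term of each increment
   of [E], the second power sum in Newton's identity the other one. *)
rewrite /= (_ : 2 * (4 / 3 * 'C(k, 2)%:R / (n%:R + 1)) = E k); last first.
  by rewrite /E natr_bin2; field; rewrite gt_eqF //; move: n256; lra.
have n0 : 0 < n%:R :> R by move: n256; lra.
have [eta0 keta eta8] := etaE.
rewrite (_ : 256 * D * _ = 8 * eta * k%:R); last first.
  by rewrite /eta; field; rewrite gt_eqF.
pose L (i : nat) : R := 1 - 2 * k%:R / n%:R + 4 / 3 * i%:R / n%:R.
apply: (@ratio_compare _ (hsymR R (n - k)) (fun i => 'C('C(n, 2), i)%:R * expR (- E i)) L W) => //.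
- by rewrite /hsymR hsymn0 bin0 /E !mul0r !mulr0 subr0 mul0r oppr0 expR0 mulr1.
- by move=> i; apply: bin_expR_gt0.
- move=> i lt_ik; have [i0 ik _ _] := Dn lt_ik.
  have : k%:R / n%:R <= 1 / 256 :> R by rewrite ler_pdivrMr //; move: ik kn'; lra.
  have : 0 <= i%:R / n%:R :> R by rewrite divr_ge0.
  rewrite /L; move: eta8; lra.
- by move=> i lt_ik; apply: hsym_step_bound.
move=> i lt_ik; have [i0 ik iD nD] := Dn lt_ik.
pose y : R := 2 * (k%:R - 1) - 4 / 3 * i%:R.
have y0 : 0 <= y by rewrite /y; move: ik i0; lra.
have yk : y <= 2 * k%:R by rewrite /y; move: ik i0; lra.
pose z : R := y / (n%:R + 1).
have n1 : 0 < n%:R + 1 :> R by move: n0; lra.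
have z0 : 0 <= z by rewrite /z divr_ge0 // ltW.
have WL : W * L i = W - (n%:R - 1) * (k%:R - 2 / 3 * i%:R).
  by rewrite /W /L; field; rewrite gt_eqF.
have Wz1 : W * z <= (n%:R - 1) / 2 * y.
  rewrite /W /z mulrA ler_pdivrMr // -subr_ge0.
  rewrite (_ : _ - _ = (n%:R - 1) / 2 * y); last by field.
  by rewrite !mulr_ge0 //; move: n256; lra.
have Wz2 : (n%:R - 2) / 2 * y <= W * z.
  rewrite /W /z mulrA ler_pdivlMr // -subr_ge0.
  by rewrite (_ : _ - _ = y); last by field.
have Wz3 : W * z ^+ 2 <= 2 * k%:R ^+ 2.
  have zn : z * n%:R <= 2 * k%:R.
    apply: le_trans yk; rewrite -[leRHS](divfK (lt0r_neq0 n1)).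
    by rewrite /z ler_wpM2l //; lra.
  have zn0 : 0 <= z * n%:R by rewrite mulr_ge0.
  have : (z * n%:R) ^+ 2 <= (2 * k%:R) ^+ 2 by rewrite ler_sqr ?nnegrE ?mulr_ge0.
  have : 0 <= z ^+ 2 * n%:R by rewrite mulr_ge0 ?exprn_ge0.
  by rewrite /W; lra.
have DD : 0 <= D * (n%:R - 256) by rewrite mulr_ge0 //; move: D1 n256; lra.
apply: (@bin_expR_step E i _ z) => //.
- by rewrite /E /z /y natSr; field; rewrite gt_eqF.
- rewrite WL; move: Wz1 DD D1 nD kn' ik i0; rewrite /y; lra.
rewrite WL; move: Wz2 Wz3 DD D1 nD kn' ik i0 kD k1; rewrite /y; lra.
Qed.

End Steps.

(** * Stirling's formula *)

Lemma derive_ge0_le (R : realType) (f df : R -> R) (a b : R) : a <= b ->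
  (forall x, a <= x -> x <= b -> is_derive x 1 f (df x)) ->
  (forall x, a <= x -> x <= b -> 0 <= df x) -> f a <= f b.
Proof.
move=> ab fdf df0.
have fdf' x : x \in `]a, b[ -> is_derive x 1 f (df x).
  by rewrite in_itv /= => /andP[/ltW ax /ltW xb]; apply: fdf.
have cf : {within `[a, b], continuous f}.
  apply: derivable_within_continuous => x.
  by rewrite in_itv /= => /andP[ax xb]; have [] := fdf x ax xb.
have [c] := MVT_segment ab fdf' cf.
rewrite in_itv /= => /andP[ac cb] fE.
by rewrite -subr_ge0 fE mulr_ge0 ?subr_ge0 ?df0.
Qed.

Lemma mul_ln_bounds (R : realType) (x : R) : 1 <= x ->
  2 * (x - 1) <= (x + 1) * ln x <= 2 * (x - 1) + (x - 1) ^+ 3 / 3.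
Proof.
move=> x1.
have lnlo y : 1 <= y -> 0 <= ln y + y^-1 - 1 :> R.
  move=> y1; have y0 : 0 < y by lra.
  have : ln (1 + (y^-1 - 1)) <= y^-1 - 1 by apply: le_ln1Dx; rewrite ltrBrDr addNr invr_gt0.
  rewrite addrCA subrr addr0 lnV ?posrE //; lra.
have lnhi y : 1 <= y -> ln y + y^-1 - 1 <= (y - 1) ^+ 2 :> R.
  move=> y1; have y0 : 0 < y by lra.
  have l : ln (1 + (y - 1)) <= y - 1 by apply: le_ln1Dx; lra.
  rewrite addrCA subrr addr0 in l.
  have : y^-1 - 1 + (y - 1) <= (y - 1) ^+ 2.
    rewrite (_ : y^-1 - 1 + (y - 1) = (y - 1) ^+ 2 / y); last by field; rewrite gt_eqF.
    by rewrite ler_piMr ?sqr_ge0 // invf_le1.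
  by lra.
pose f y : R := (y + 1) * ln y - 2 * (y - 1).
have df (y : R) : 1 <= y -> is_derive y 1 f (ln y + y^-1 - 1).
  move=> y1; have y0 : 0 < y by lra.
  have := is_derive1_ln y0 => dln; rewrite /f.
  apply: trigger_derive; rewrite /GRing.scale /=.
  by field; rewrite gt_eqF.
pose g y : R := 2 * (y - 1) + (y - 1) ^+ 3 / 3 - (y + 1) * ln y.
have dg (y : R) : 1 <= y -> is_derive y 1 g ((y - 1) ^+ 2 - (ln y + y^-1 - 1)).
  move=> y1; have y0 : 0 < y by lra.
  have := is_derive1_ln y0 => dln; rewrite /g.
  apply: trigger_derive; rewrite /GRing.scale /=.
  by field; rewrite gt_eqF.
have f1 : f 1 <= f x.
  by apply: (@derive_ge0_le _ f _ 1 x x1) => [y y1 _|y y1 _]; [exact: df | exact: lnlo].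
have g1 : g 1 <= g x.
  pose dg' y : R := (y - 1) ^+ 2 - (ln y + y^-1 - 1).
  apply: (@derive_ge0_le _ g dg' 1 x x1) => [y y1 _|y y1 _]; first exact: dg.
  by rewrite subr_ge0 lnhi.
move: f1 g1; rewrite /f /g !subrr !ln1 !expr0n /= !mulr0 !mul0r; lra.
Qed.

Section Wallis.
Variable R : realType.

(* The reduction formula, solved for an antiderivative of [cos ^+ n]. *)
Fixpoint cosX_prim (n : nat) (x : R) : R :=
  match n with
  | 0 => x
  | 1 => sin x
  | n'.+2 => (cos x ^+ n'.+1 * sin x + n'.+1%:R * cosX_prim n' x) / n'.+2%:R
  end.

Lemma is_derive_cosX_prim n (x : R) : is_derive x 1 (cosX_prim n) (cos x ^+ n).
Proof.
elim/ltn_ind: n x => -[|[|n]] IH x.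
- by rewrite expr0; apply: is_derive_id.
- by rewrite expr1; apply: is_derive_sin.
have dn := IH n (ltnW (ltnSn _)) x.
have n2 : n.+2%:R != 0 :> R by rewrite pnatr_eq0.
rewrite /=.
have d1 : is_derive x 1 (fun y => cos y ^+ n.+1 : R) (- (n.+1%:R * cos x ^+ n * sin x)).
  rewrite (_ : (fun y => _) = cos ^+ n.+1); last by rewrite exprfctE.
  by apply: is_derive_eq; rewrite /GRing.scale /= mulrN.
have d2 : is_derive x 1 (fun y => cos y ^+ n.+1 * sin y)
    (cos x ^+ n.+1 * cos x - n.+1%:R * cos x ^+ n * sin x ^+ 2).
  by apply: trigger_derive; rewrite /GRing.scale /=; ring.
have d3 : is_derive x 1 (fun y => n.+1%:R * cosX_prim n y : R) (n.+1%:R * cos x ^+ n).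
  apply: trigger_derive; rewrite /GRing.scale /=. by ring.
apply: trigger_derive; rewrite /GRing.scale /= !mulr0 add0r.
apply: (mulfI n2); rewrite mulrA mulfV // mul1r sin2cos2 !exprS (natSr R n.+1).
ring.
Qed.

Let W n : R := cosX_prim n (pi / 2).

Lemma wallisSS n : n.+2%:R * W n.+2 = n.+1%:R * W n.
Proof.
by rewrite /W /= cos_pihalf exprS !mul0r add0r mulrC divfK.
Qed.

Lemma wallis_gt0 n : 0 < W n.
Proof.
elim/ltn_ind: n => -[|[|n]] IH; first by rewrite /W /= divr_gt0 // pi_gt0.
  by rewrite /W /= sin_pihalf.
have := IH n (ltnW (ltnSn _)).
by rewrite -(pmulr_rgt0 _ (ltr0Sn R n)) -wallisSS pmulr_rgt0.
Qed.

Lemma wallis_le n : W n.+1 <= W n.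
Proof.
have c0 m : cosX_prim m 0 = 0 :> R.
  elim/ltn_ind: m => -[|[|m]] IH //=; first by rewrite sin0.
  by rewrite sin0 mulr0 add0r IH ?mulr0 ?mul0r // ltnW.
pose f x := cosX_prim n x - cosX_prim n.+1 x : R.
pose df (x : R) : R := cos x ^+ n - cos x ^+ n.+1.
have pi2 : 0 <= pi / 2 :> R by rewrite divr_ge0 // pi_ge0.
have : f 0 <= f (pi / 2).
  apply: (@derive_ge0_le _ f df 0 (pi / 2) pi2) => x x0 xpi.
    by apply: is_deriveB; apply: is_derive_cosX_prim.
  have cx : 0 <= cos x by apply: cos_ge0_pihalf; rewrite xpi andbT (le_trans _ x0) // oppr_le0.
  rewrite /df subr_ge0 exprS ler_piMl ?exprn_ge0 ?cos_le1 //.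
by rewrite /f !c0 subrr subr_ge0.
Qed.

Lemma wallisM n : n.+1%:R * (W n * W n.+1) = pi / 2.
Proof.
elim: n => [|n IH]; first by rewrite /W /= sin_pihalf mulr1 mul1r.
by rewrite mulrCA wallisSS mulrCA (mulrC (W n.+1)).
Qed.

Lemma wallis_even n : 4 ^+ n * n`!%:R ^+ 2 * W n.*2 = pi / 2 * (n.*2)`!%:R.
Proof.
elim: n => [|n IH]; first by rewrite /W !fact0 !expr0 expr1n !mul1r mulr1.
have n2 : n.*2.+2%:R = 2 * n.+1%:R :> R by rewrite -doubleS -mul2n natrM.
rewrite doubleS !factS !natrM.
have -> : pi / 2 * (n.*2.+2%:R * (n.*2.+1%:R * (n.*2)`!%:R)) =
  n.*2.+2%:R * n.*2.+1%:R * (pi / 2 * (n.*2)`!%:R) :> R by ring.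
rewrite -IH exprS.
have -> : 4 * 4 ^+ n * (n.+1%:R * n`!%:R) ^+ 2 * W n.*2.+2 =
  4 ^+ n * n`!%:R ^+ 2 * n.*2.+2%:R * (n.*2.+2%:R * W n.*2.+2) by rewrite n2; ring.
by rewrite wallisSS; ring.
Qed.

Lemma wallis_bounds n : (0 < n)%N ->
  pi / 4 - pi / (8 * n%:R) <= n%:R * W n.*2 ^+ 2 <= pi / 4.
Proof.
case: n => // n _; set x : R := n.+1%:R.
have x0 : 0 < x by rewrite ltr0n.
have dE : n.+1.*2%:R = 2 * x by rewrite -mul2n natrM.
have W0 := wallis_gt0 n.+1.*2.
apply/andP; split.
  have lo : pi / 2 <= (2 * x + 1) * W n.+1.*2 ^+ 2.
    rewrite -(wallisM n.+1.*2) (natSr R n.+1.*2) dE expr2 ler_wpM2l ?ler_wpM2l ?wallis_le ?(ltW W0) //.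
    lra.
  have x1 : 0 < 2 * x + 1 by lra.
  have pi0 := pi_gt0 R.
  have -> : pi / 4 - pi / (8 * x) = x / (2 * x + 1) * (pi / 2) - pi / (8 * x * (2 * x + 1)).
    by field; rewrite !gt_eqF.
  have : x / (2 * x + 1) * (pi / 2) <= x * W n.+1.*2 ^+ 2.
    rewrite -[leRHS](mulfVK (lt0r_neq0 x1)).
    rewrite (_ : x * _ / _ * _ = x / (2 * x + 1) * ((2 * x + 1) * W n.+1.*2 ^+ 2)); last by ring.
    by rewrite ler_wpM2l // divr_ge0 // ltW.
  by apply: le_trans; rewrite gerBl divr_ge0 ?mulr_ge0 ?ltW.
have hi : 2 * x * W n.+1.*2 ^+ 2 <= pi / 2.
  rewrite -(wallisM n.*2.+1) -doubleS dE expr2 ler_wpM2l ?ler_wpM2r ?wallis_le ?(ltW W0) //.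
  lra.
lra.
Qed.

End Wallis.

Section Stirling.
Variable R : realType.

Definition stirling_log (n : nat) : R := ln n`!%:R - (n%:R + 1 / 2) * ln n%:R + n%:R.

Lemma fact_stirling_log n : (0 < n)%N ->
  n`!%:R = expR (stirling_log n + (n%:R + 1 / 2) * ln n%:R - n%:R) :> R.
Proof.
move=> n0; rewrite (_ : _ - _ = ln n`!%:R); last by rewrite /stirling_log; ring.
by rewrite lnK // posrE ltr0n fact_gt0.
Qed.

Lemma stirling_log_step n : (0 < n)%N ->
  0 <= stirling_log n - stirling_log n.+1 <= 1 / (3 * n%:R) - 1 / (3 * n.+1%:R).
Proof.
move=> n0; have x0 : 0 < n%:R :> R by rewrite ltr0n.
have x1 : 1 <= n%:R :> R by rewrite ler1n.
have S0 : 0 < n.+1%:R :> R by rewrite ltr0n.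
have f0 : 0 < n`!%:R :> R by rewrite ltr0n fact_gt0.
have -> : stirling_log n - stirling_log n.+1 =
    (n%:R + 1 / 2) * (ln n.+1%:R - ln n%:R) - 1.
  rewrite /stirling_log factS natrM lnM ?posrE // (natSr R n); ring.
rewrite -ln_div ?posrE // (_ : n.+1%:R / n%:R = 1 + n%:R^-1); last first.
  by rewrite (natSr R n) mulrDl mulfV ?gt_eqF // mul1r.
set y := n%:R^-1.
have y0 : 0 <= y by rewrite invr_ge0.
have xy : n%:R * y = 1 by rewrite mulfV // gt_eqF.
have := @mul_ln_bounds R (1 + y); rewrite lerDl => /(_ y0) /andP[].
rewrite addrAC subrr add0r => lo hi.
have lnE : (n%:R + 1 / 2) * ln (1 + y) = n%:R / 2 * ((1 + y + 1) * ln (1 + y)).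
  transitivity ((n%:R + n%:R * y / 2) * ln (1 + y)); first by rewrite xy.
  by field.
have n2 : 0 <= n%:R / 2 :> R by rewrite divr_ge0.
rewrite lnE; apply/andP; split.
  have := ler_wpM2l n2 lo.
  have -> : n%:R / 2 * (2 * y) = n%:R * y by field.
  by rewrite xy subr_ge0.
have := ler_wpM2l n2 hi.
have -> : n%:R / 2 * (2 * y + y ^+ 3 / 3) = n%:R * y * (1 + y ^+ 2 / 6) by field.
rewrite xy mul1r => h.
rewrite lerBlDl; apply: le_trans h _; rewrite lerD2l (natSr R n).
rewrite -subr_ge0 /y (_ : _ - _ = (n%:R - 1) / (6 * n%:R ^+ 2 * (n%:R + 1))).
  by rewrite divr_ge0 ?mulr_ge0 ?subr_ge0 ?exprn_ge0 ?addr_ge0.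
by field; rewrite !gt_eqF // ltr_wpDl.
Qed.

Lemma stirling_log_cvg : cvgn (fun n => stirling_log n.+1).
Proof.
apply: nonincreasing_is_cvgn.
  apply/nonincreasing_seqP => n; rewrite -subr_ge0.
  by have /andP[] := stirling_log_step (ltn0Sn n).
exists (stirling_log 1 - 1 / 3) => _ [n _ <-].
suff : stirling_log 1 - 1 / 3 <= stirling_log n.+1 - 1 / (3 * n.+1%:R).
  have : 0 <= 1 / (3 * n.+1%:R) :> R by rewrite divr_ge0 // mulr_ge0.
  by move=> h1 h2; apply: le_trans h2 _; rewrite gerBl.
elim: n => [|n IH]; first by rewrite mulr1.
apply: le_trans IH _; have /andP[_] := stirling_log_step (ltn0Sn n).
by move: (1 / _) (1 / _) => u v; lra.
Qed.

Lemma stirling : expR (stirling_log n) @[n --> \oo] --> (Num.sqrt (2 * pi) : R).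
Proof.
have [l cl] : exists l : R, stirling_log n.+1 @[n --> \oo] --> l.
  by eexists; exact: stirling_log_cvg.
have el : expR (stirling_log n.+1) @[n --> \oo] --> expR l.
  by apply: continuous_cvg => //; apply: continuous_expR.
have el0 := expR_gt0 l.
pose W n : R := cosX_prim n (pi / 2).
pose w n := 2 * (pi / 2) ^+ 2 / (n.+1%:R * W n.+1.*2 ^+ 2).
have wE n : w n = (expR (stirling_log n.+1) ^+ 2 / expR (stirling_log (n.*2.+1).+1)) ^+ 2.
  have W0 : 0 < W n.+1.*2 by apply: wallis_gt0.
  have x0 : 0 < n.+1%:R :> R by rewrite ltr0n.
  have pi2 : 0 < pi / 2 :> R by rewrite divr_gt0 // pi_gt0.
  have f0 m : 0 < m`!%:R :> R by rewrite ltr0n fact_gt0.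
  have -> : w n = expR (ln (w n)).
    by rewrite lnK // posrE; apply: divr_gt0; apply: mulr_gt0 => //; apply: exprn_gt0.
  rewrite -!expRM_natl -expRB -expRM_natl; congr expR.
  have lnw (x p v : R) : 0 < x -> 0 < p -> 0 < v ->
      ln (2 * p ^+ 2 / (x * v ^+ 2)) = ln 2 + 2 * ln p - (ln x + 2 * ln v).
    move=> {}x0 p0 v0; have p2 := exprn_gt0 2 p0; have v2 := exprn_gt0 2 v0.
    rewrite ln_div ?posrE ?mulr_gt0 // !lnM ?posrE //.
    by ring.
  have lnwal (m : nat) (f p v g : R) : 0 < f -> 0 < p -> 0 < v -> 0 < g ->
      4 ^+ m * f ^+ 2 * v = p * g -> m%:R * (2 * ln 2) + 2 * ln f + ln v = ln p + ln g.
    move=> {}f0 p0 v0 g0; have f2 := exprn_gt0 2 f0.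
    have m4 : 0 < 4 ^+ m :> R by apply: exprn_gt0.
    move=> /(congr1 (@ln R)); rewrite !lnM ?posrE ?mulr_gt0 // !lnXn // => <-.
    rewrite (_ : 4 = 2 * 2 :> R); last by ring.
    by rewrite lnM ?posrE //; ring.
  have := lnwal _ _ _ _ _ (f0 n.+1) pi2 W0 (f0 n.+1.*2) (wallis_even R n.+1).
  rewrite lnw // /stirling_log -doubleS.
  have -> : n.+1.*2%:R = 2 * n.+1%:R :> R by rewrite -mul2n natrM.
  rewrite [ln (2 * n.+1%:R)]lnM ?posrE //.
  lra.
have cw : w n @[n --> \oo] --> 2 * pi.
  have pi0 := pi_gt0 R.
  have piE (p : R) : 0 < p -> 2 * p = 2 * (p / 2) ^+ 2 / (p / 4).
    by move=> p0; field; rewrite gt_eqF.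
  rewrite [X in _ --> X]piE //.
  apply: cvgM; first exact: cvg_cst.
  apply: cvgV; first by rewrite gt_eqF // divr_gt0.
  apply: (@squeeze_cvgr _ _ _ _ (fun n : nat => pi / 4 - pi / 8 * n.+1%:R^-1) (cst (pi / 4))).
  - apply: nearW => n; have := wallis_bounds R (ltn0Sn n); rewrite -/(W _).
    by rewrite invfM mulrA.
  - rewrite -[X in _ --> X]subr0; apply: cvgB; first exact: cvg_cst.
    rewrite -[X in _ --> X](mulr0 (pi / 8)); apply: cvgM; first exact: cvg_cst.
    exact: cvg_harmonic.
  - exact: cvg_cst.
have cw' : w n @[n --> \oo] --> expR l ^+ 2.
  rewrite (funext wE).
  have -> : expR l ^+ 2 = (expR l ^+ 2 / expR l) ^+ 2 by field; rewrite gt_eqF.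
  rewrite expr2; under eq_fun do rewrite expr2.
  have c2 : expR (stirling_log n.+1) ^+ 2 / expR (stirling_log (n.*2.+1).+1) @[n --> \oo]
      --> expR l ^+ 2 / expR l.
    apply: cvgM.
      rewrite expr2; under eq_fun do rewrite expr2.
      exact: cvgM.
    apply: cvgV; first by rewrite gt_eqF.
    apply: (cvg_comp (fun n : nat => n.*2.+1) (fun n => expR (stirling_log n.+1)) _ el).
    move=> A [N _ NA]; exists N => // m /= Nm; apply: NA => /=.
    by rewrite (leq_trans Nm) // -addnn -addnS leq_addr.
  exact: cvgM.
have e2 : expR l ^+ 2 = 2 * pi by apply: cvg_unique cw' cw.
rewrite -e2 sqrtr_sqr gtr0_norm //.
by rewrite -(cvg_shiftS (fun n => expR (stirling_log n))).
Qed.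

End Stirling.

(** * Asymptotics *)

Lemma near_stirling_approx (R : realType) (D : R) : 1 <= D ->
  \forall n \near \oo, forall m, (m <= n)%N -> (n%:R - m%:R) ^+ 2 <= D * n%:R ->
    let B := 'C('C(n, 2), n - m)%:R : R in
    [/\ 0 < B,
        `|esymR R n (n - m) - B * expR (- mu R n m)|
          <= 256 * D * ((n%:R - m%:R) / n%:R) * (B * expR (- mu R n m))
      & `|hsymR R m (n - m) - B * expR (- (2 * mu R n m))|
          <= 256 * D * ((n%:R - m%:R) / n%:R) * (B * expR (- (2 * mu R n m)))].
Proof.
move=> D1; near=> n.
have n3 : (3 <= n)%N by near: n; exists 3%N.
have nD : (256 * D) ^+ 2 * D <= n%:R by near: n; apply: nbhs_infty_ger.
move=> m le_mn kD /=.
have n0 : 0 < n%:R :> R by rewrite ltr0n (leq_trans _ n3).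
have le_nN : (n <= 'C(n, 2))%N.
  rewrite -(ler_nat R) natr_bin2; have : 3 <= n%:R :> R by rewrite ler_nat.
  move=> h; have : 0 <= n%:R * (n%:R - 3) :> R by rewrite mulr_ge0 ?subr_ge0.
  lra.
split; first by rewrite ltr0n bin_gt0 (leq_trans (leq_subr _ _)).
all: rewrite -natrB // in kD *.
all: case: (posnP (n - m)) => [k0|k_gt0].
1,3: by rewrite /mu k0 /esymR /hsymR ?esymn0 ?hsymn0 !bin0n !mul0n mul0r ?mulr0 oppr0 expR0
  bin0 mulr1 subrr normr0 mul0r mulr0 mul0r.
all: have kn : 256 * (n - m)%:R * D <= n%:R.
1,3: rewrite -ler_sqr ?nnegrE ?mulr_ge0 //; try lra.
1,2: have D2 : 0 <= (256 * D) ^+ 2 by rewrite sqr_ge0.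
1,2: have := ler_wpM2l D2 kD; have := ler_wpM2r (ltW n0) nD; lra.
  by rewrite muE // -/(esymR _ _ _); apply: esym_approx.
rewrite muE // -{1}(subKn le_mn); apply: hsym_approx => //.
exact: leq_subr.
Unshelve. all: by end_near.
Qed.

Lemma eq_up_to_bigO_bound (R : realType) (f g e : nat -> R) (C : R) : 0 < C ->
  (\forall n \near \oo, 0 < g n /\ `|f n - g n| <= C * e n * g n) ->
  eq_up_to_bigO f g e.
Proof.
move=> C0 H; exists (fun n => f n / g n - 1); split.
  apply/eqO_exP; exists C => //; near=> n.
  have [g0 fg] : 0 < g n /\ `|f n - g n| <= C * e n * g n by near: n.
  rewrite -[X in _ - X](mulfV (lt0r_neq0 g0)) -mulrBl normrM normfV (gtr0_norm g0).
  rewrite ler_pdivrMr //; apply: le_trans fg _; rewrite ler_wpM2r ?(ltW g0) // ler_wpM2l ?(ltW C0) //.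
  exact: ler_norm.
near=> n; have [g0 _] : 0 < g n /\ `|f n - g n| <= C * e n * g n by near: n.
by rewrite addrCA subrr addr0 mulrCA mulfV ?mulr1 // gt_eqF.
Unshelve. all: by end_near.
Qed.

Lemma stirling_bigO (R : realType) (s S : nat -> nat -> int)
    (hs : is_stirling1 s) (hS : is_stirling2 S) (m : nat -> nat) :
  (forall n, (m n <= n)%N) ->
  (fun n => n%:R - (m n)%:R : R) =O_\oo (fun n => Num.sqrt (n%:R : R)) ->
  eq_up_to_bigO
    (fun n => `|s n (m n)|%:~R : R)
    (fun n => 'C('C(n, 2), n - m n)%:R * expR (- mu R n (m n)))
    (fun n => (n%:R - (m n)%:R) / n%:R)
  /\
  eq_up_to_bigO
    (fun n => (S n (m n))%:~R : R)
    (fun n => 'C('C(n, 2), n - m n)%:R * expR (- (2 * mu R n (m n))))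
    (fun n => (n%:R - (m n)%:R) / n%:R).
Proof.
move=> le_mn /eqO_exP [K K0 mO].
pose D := 1 + K ^+ 2.
have D1 : 1 <= D by rewrite lerDl sqr_ge0.
have H : \forall n \near \oo, (n%:R - (m n)%:R) ^+ 2 <= D * n%:R :> R.
  near=> n; have : `|n%:R - (m n)%:R| <= K * `|Num.sqrt n%:R| :> R by near: n.
  rewrite -ler_sqr ?nnegrE ?mulr_ge0 ?(ltW K0) // exprMn !real_normK ?num_real //.
  rewrite sqr_sqrtr // => h; apply: le_trans h _.
  by rewrite ler_wpM2r // lerDr.
have C0 : 0 < 256 * D by rewrite mulr_gt0 // (lt_le_trans ltr01).
have approx := near_stirling_approx D1.
split; apply: (eq_up_to_bigO_bound C0).
  apply: filterS2 H approx => n Dn /(_ _ (le_mn n) Dn) [B0 h _].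
  by rewrite stirling1_esym // natz -pmulrn mulr_gt0 ?expR_gt0.
apply: filterS2 H approx => n Dn /(_ _ (le_mn n) Dn) [B0 _ h].
by rewrite (stirling2_hsym hS) // natz -pmulrn mulr_gt0 ?expR_gt0.
Unshelve. all: by end_near.
Qed.

Lemma ffact_ge (R : realFieldType) (N k : nat) : (k <= N)%N ->
  N%:R ^+ k * (1 - k%:R ^+ 2 / N%:R) <= (N ^_ k)%:R :> R.
Proof.
elim: k => [_|k IH lt_kN]; first by rewrite expr2 !mul0r subr0 mulr1.
have N0 : 0 < N%:R :> R by rewrite ltr0n (leq_ltn_trans _ lt_kN).
have kN : 0 <= N%:R - k%:R :> R by rewrite subr_ge0 ler_nat ltnW.
rewrite ffactnSr natrM natrB ?(ltnW lt_kN) //.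
apply: le_trans (ler_wpM2r kN (IH (ltnW lt_kN))).
rewrite exprSr -!mulrA ler_wpM2l ?exprn_ge0 // -subr_ge0.
rewrite (natSr R k) (_ : _ - _ = k%:R + 1 + k%:R ^+ 3 / N%:R); last by field; rewrite gt_eqF.
by rewrite !addr_ge0 // divr_ge0 // exprn_ge0.
Qed.

Lemma ffact_le (R : realFieldType) (N k : nat) : (N ^_ k)%:R <= N%:R ^+ k :> R.
Proof.
elim: k => [|k IH]; first by rewrite expr0.
by rewrite ffactnSr natrM exprSr ler_pM // ler_nat leq_subr.
Qed.

Lemma bernoulli_le (R : realFieldType) (x : R) k : 0 <= x -> x <= 1 ->
  1 - k%:R * x <= (1 - x) ^+ k.
Proof.
move=> x0 x1; elim: k => [|k IH]; first by rewrite mul0r subr0.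
have y0 : 0 <= 1 - x by rewrite subr_ge0.
rewrite exprSr (natSr R k); apply: le_trans (ler_wpM2r y0 IH).
have : 0 <= k%:R * (x * x) by rewrite !mulr_ge0.
lra.
Qed.

Section Special.
Variables (R : realType) (t a : R) (m : nat -> nat).
Hypotheses (t0 : 0 < t) (a1 : a <= 1 / 2).

Let F := within [set n | (m n)%:R = n%:R - t * n%:R `^ a] \oo.
Local Notation k n := (n - m n)%N.

Local Instance FF : Filter F. Proof. exact: within_filter. Qed.

Lemma special_near : \forall n \near F,
  [/\ (2 <= n)%N, (m n <= n)%N, (k n)%:R = t * n%:R `^ a :> R
    & (k n)%:R ^+ 2 <= t ^+ 2 * n%:R :> R].
Proof.
rewrite near_withinE; near=> n => /= mn.
have n2 : (2 <= n)%N by near: n; exists 2%N.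
have n0 : 0 < n%:R :> R by rewrite ltr0n (leq_trans _ n2).
have le_mn : (m n <= n)%N.
  by rewrite -(ler_nat R) mn gerBl mulr_ge0 ?powR_ge0 // ltW.
have kE : (k n)%:R = t * n%:R `^ a :> R.
  by rewrite natrB // mn subKr.
split=> //; rewrite kE exprMn ler_wpM2l ?sqr_ge0 //.
rewrite -[leRHS](powRr1 (ltW n0)) expr2 -powRD; last by rewrite lt0r_neq0 ?implybT.
by rewrite ler_powR ?ler1n ?(leq_trans _ n2) //; move: a1; lra.
Unshelve. all: by end_near.
Qed.

Lemma special_cvg0 : (k n)%:R / n%:R @[n --> F] --> (0 : R).
Proof.
apply/cvgrPdist_le => e e0.
have big : \forall n \near F, t ^+ 2 / e ^+ 2 <= n%:R.
  by apply: cvg_within; apply: nbhs_infty_ger.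
apply: filterS2 special_near big => n [n2 _ _ kn] ne.
have n0 : 0 < n%:R :> R by rewrite ltr0n (leq_trans _ n2).
rewrite sub0r normrN ger0_norm ?divr_ge0 // ler_pdivrMr //.
rewrite -ler_sqr ?nnegrE ?mulr_ge0 ?(ltW e0) //.
apply: le_trans kn _; rewrite (_ : (e * n%:R) ^+ 2 = e ^+ 2 * n%:R * n%:R); last by ring.
rewrite ler_wpM2r //.
by rewrite mulrC -ler_pdivrMr // exprn_gt0.
Qed.

Lemma special_powR n : (0 < n)%N -> (k n)%:R = t * n%:R `^ a :> R ->
  t ^+ 2 * n%:R `^ (2 * a - 1) = (k n)%:R ^+ 2 / n%:R.
Proof.
move=> n0 ->; have nn0 : n%:R != 0 :> R by rewrite pnatr_eq0 -lt0n.
rewrite powRB ?nn0 ?implybT // powRr1 // exprMn.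
by rewrite [2 * a]mulrC powRrM powR_mulrn ?powR_ge0 // mulrA.
Qed.

Lemma asymp_binomial_form (j C : R) (f : nat -> R) :
  let g n := 'C('C(n, 2), k n)%:R * expR (- (j * mu R n (m n))) in
  (\forall n \near F, 0 < g n /\ `|f n - g n| <= C * ((k n)%:R / n%:R) * g n) ->
  asymp_eq F f (binomial_form (j * (2 / 3)) t a m).
Proof.
move=> g fg.
pose d n : R := j * (2 / 3 * ((k n)%:R ^+ 2 + (k n)%:R * n%:R) / (n%:R * (n%:R + 1))).
have d0 : d n @[n --> F] --> (0 : R).
  rewrite -[X in _ --> X](mulr0 j); apply: cvgM; first exact: cvg_cst.
  apply: (@squeeze_cvgr _ _ _ _ (cst 0) (fun n => 4 / 3 * ((k n)%:R / n%:R))).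
  - apply: filterS special_near => n [n2 le_mn _ _].
    have n0 : 0 < n%:R :> R by rewrite ltr0n (leq_trans _ n2).
    have n1 : 0 < n%:R + 1 :> R by rewrite addr_gt0.
    have kn : (k n)%:R <= n%:R :> R by rewrite ler_nat leq_subr.
    rewrite /= divr_ge0 ?mulr_ge0 ?addr_ge0 ?sqr_ge0 ?(ltW n1) //=.
    rewrite ler_pdivrMr ?mulr_gt0 // -subr_ge0.
    rewrite (_ : _ - _ = 2 / 3 * (k n)%:R * (n%:R - (k n)%:R + 2)); last first.
      by field; rewrite gt_eqF.
    by apply: mulr_ge0; [rewrite mulr_ge0 // divr_ge0 | rewrite addr_ge0 // subr_ge0].
  - exact: cvg_cst.
  rewrite -[X in _ --> X](mulr0 (4 / 3)); apply: cvgM; first exact: cvg_cst.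
  exact: special_cvg0.
have ed : expR (d n) @[n --> F] --> (1 : R).
  by rewrite -(expR0 R); apply: continuous_cvg d0; apply: continuous_expR.
have fg1 : f n / g n @[n --> F] --> (1 : R).
  apply/cvgrPdist_le => e e0.
  have Ck : C * ((k n)%:R / n%:R) @[n --> F] --> (0 : R).
    by rewrite -[X in _ --> X](mulr0 C); apply: cvgM; [exact: cvg_cst | exact: special_cvg0].
  move/cvgrPdist_le : Ck => /(_ e e0) Ck.
  apply: filterS2 fg Ck => n [g0 fgn]; rewrite sub0r normrN => Cke.
  rewrite distrC -[X in _ - X](mulfV (lt0r_neq0 g0)) -mulrBl normrM normfV (gtr0_norm g0).
  rewrite ler_pdivrMr //; apply: le_trans fgn _; rewrite ler_wpM2r ?(ltW g0) //.
  exact: le_trans (ler_norm _) Cke.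
rewrite /asymp_eq -[X in _ --> X](mulr1 1).
apply: cvg_trans (cvgM fg1 ed).
apply: near_eq_cvg.
have n3 : \forall n \near F, (3 <= n)%N by apply: cvg_within; exists 3%N.
near=> n.
have n3' : (3 <= n)%N by near: n.
have [n2 le_mn kE _] : [/\ (2 <= n)%N, (m n <= n)%N, (k n)%:R = t * n%:R `^ a :> R
    & (k n)%:R ^+ 2 <= t ^+ 2 * n%:R :> R] by near: n; apply: special_near.
have [g0 _] : 0 < g n /\ `|f n - g n| <= C * ((k n)%:R / n%:R) * g n by near: n.
have n0 : 0 < n%:R :> R by rewrite ltr0n (leq_trans _ n2).
have bfE : binomial_form (j * (2 / 3)) t a m n = g n * expR (- d n).
  rewrite /binomial_form -[j * _ * _ * _]mulrA special_powR ?(leq_trans _ n2) //.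
  rewrite /g -[RHS]mulrA -expRD; congr (_ * expR _).
  rewrite muE // natr_bin2 /d; field.
  by rewrite !gt_eqF // addr_gt0.
transitivity (f n / g n * expR (d n)) => //.
rewrite bfE (expRN (d n)); move: (f n) (g n) (expR _) => u v w.
by rewrite invfM invrK mulrA.
Unshelve. all: by end_near.
Qed.

Lemma asymp_explicit_form (c : R) : 0 < a ->
  asymp_eq F (binomial_form c t a m) (explicit_form c t a).
Proof.
move=> ap; pose N n := 'C(n, 2).
pose P n : R := (N n ^_ k n)%:R / (N n)%:R ^+ k n * (1 - n%:R^-1) ^+ k n.
have koo : (fun n => k n) @ F --> \oo.
  suff H (B : nat) : \forall n \near F, (B <= k n)%N.
    by move=> A [B _ BA]; apply: filterS (H B) => n; apply: BA.
  have big : \forall n \near F, (B%:R / t) `^ (a^-1) <= n%:R.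
    by apply: cvg_within; apply: nbhs_infty_ger.
  apply: filterS2 special_near big => n [n2 _ kE _] h.
  rewrite -(ler_nat R) kE -ler_pdivrMl // mulrC.
  have Bt : 0 <= B%:R / t by rewrite divr_ge0 // ltW.
  rewrite -[leLHS]powRr1 // -[X in _ `^ X](mulVf (lt0r_neq0 ap)) powRrM.
  by rewrite ge0_ler_powR ?(ltW ap) ?nnegrE ?powR_ge0.
have P1 : P n @[n --> F] --> (1 : R).
  pose lo n : R := 1 - 4 * ((k n)%:R / n%:R) ^+ 2 - (k n)%:R / n%:R.
  apply: (@squeeze_cvgr _ _ _ _ lo (cst 1)); last exact: cvg_cst.
    apply: filterS special_near => n [n2 le_mn _ _].
    have n2R : 2 <= n%:R :> R by rewrite ler_nat.
    have n0 : 0 < n%:R :> R by lra.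
    have NE : (N n)%:R = n%:R * (n%:R - 1) / 2 :> R by rewrite natr_bin2.
    have N0 : 0 < (N n)%:R :> R by rewrite ltr0n bin_gt0.
    have v0 : 0 <= n%:R^-1 :> R by rewrite invr_ge0 ltW.
    have v1 : n%:R^-1 <= 1 :> R by rewrite invf_le1 //; lra.
    set x : R := (N n ^_ k n)%:R / (N n)%:R ^+ k n.
    have Nk0 : 0 < (N n)%:R ^+ k n :> R by rewrite exprn_gt0.
    have x1 : x <= 1 by rewrite ler_pdivrMr // mul1r ffact_le.
    have x0 : 0 <= x by rewrite divr_ge0 // ltW.
    have xlo : 1 - 4 * ((k n)%:R / n%:R) ^+ 2 <= x.
      have [kN|Nk] := leqP (k n) (N n).
        rewrite ler_pdivlMr // mulrC; apply: le_trans (ffact_ge R kN).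
        rewrite ler_wpM2l ?(ltW Nk0) // lerD2l lerN2.
        rewrite ler_pdivrMr // exprMn exprVn NE.
        rewrite (_ : 4 * _ * _ = (k n)%:R ^+ 2 * (2 * (n%:R - 1) / n%:R)); last by field; rewrite gt_eqF.
        by rewrite ler_peMr ?sqr_ge0 // ler_pdivlMr //; lra.
      apply: le_trans x0; rewrite subr_le0.
      have kn : 1 / 2 <= (k n)%:R / n%:R :> R.
        rewrite ler_pdivlMr //; apply: (@le_trans _ _ (N n)%:R); last by rewrite ler_nat ltnW.
        have : 0 <= n%:R * (n%:R - 2) :> R by rewrite mulr_ge0 ?subr_ge0.
        by rewrite NE; lra.
      have : (1 / 2) ^+ 2 <= ((k n)%:R / n%:R) ^+ 2 :> R.
        by rewrite ler_sqr ?nnegrE ?divr_ge0 // ltW.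
      lra.
    have y1 : (1 - n%:R^-1) ^+ k n <= 1 :> R.
      by rewrite exprn_ile1 ?subr_ge0 // gerBl.
    have y0 : 0 <= (1 - n%:R^-1) ^+ k n :> R by rewrite exprn_ge0 // subr_ge0.
    have ylo := bernoulli_le (k n) v0 v1.
    rewrite /P -/x /=; apply/andP; split; last by rewrite mulr_ile1.
    have := ler_wpM2l x0 ylo; have := ler_wpM2r (mulr_ge0 (ler0n R (k n)) v0) x1.
    rewrite /lo; lra.
  have kc := special_cvg0.
  rewrite (_ : 1 = 1 - 4 * 0 ^+ 2 - 0 :> R); last by ring.
  apply: cvgB => //; apply: cvgB; first exact: cvg_cst.
  apply: cvgM; first exact: cvg_cst.
  rewrite expr2; under eq_fun do rewrite expr2.
  exact: cvgM.
have sq0 : 0 < Num.sqrt (2 * pi) :> R by rewrite sqrtr_gt0 mulr_gt0 // pi_gt0.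
have S1 : Num.sqrt (2 * pi) / expR (stirling_log R (k n)) @[n --> F] --> (1 : R).
  rewrite -[X in _ --> X](mulfV (lt0r_neq0 sq0)); apply: cvgM; first exact: cvg_cst.
  apply: cvgV; first exact: lt0r_neq0.
  exact: (cvg_comp (fun n => k n) (fun i => expR (stirling_log R i)) koo (@stirling R)).
rewrite /asymp_eq -[X in _ --> X](mulr1 1).
apply: cvg_trans (cvgM P1 S1).
apply: near_eq_cvg.
apply: filterS special_near => n [n2 le_mn kE _] /=.
have n0 : 0 < n%:R :> R by rewrite ltr0n (leq_trans _ n2).
have p0 : 0 < n%:R `^ a by apply: powR_gt0.
have K0 : 0 < (k n)%:R :> R by rewrite kE mulr_gt0.
have lnK' : ln (k n)%:R = ln t + a * ln n%:R by rewrite kE lnM ?posrE // ln_powR.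
pose y : R := (2 * (k n)%:R + 1) * ln t + a * ln n%:R.
have sqE : Num.sqrt (2 * pi * t `^ (2 * (t * n%:R `^ a) + 1) * n%:R `^ a)
    = Num.sqrt (2 * pi) * expR (y / 2).
  rewrite -mulrA sqrtrM ?mulr_ge0 ?pi_ge0 //; congr (_ * _).
  rewrite -[RHS](gtr0_norm (expR_gt0 _)) -sqrtr_sqr; congr Num.sqrt.
  rewrite -[LHS]lnK ?posrE ?mulr_gt0 ?powR_gt0 //.
  rewrite lnM ?posrE ?powR_gt0 // !ln_powR -kE -/y -expRM_natl; congr expR.
  by field.
rewrite /binomial_form /explicit_form sqE -kE -/(N n).
set E := c * _ * _; set Q := (k n)%:R * _; rewrite expRB expRN.
have fK : 'C(N n, k n)%:R * (k n)`!%:R = (N n ^_ k n)%:R :> R.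
  by rewrite -natrM bin_ffact.
have N0 : 0 < (N n)%:R :> R by rewrite ltr0n bin_gt0.
have powE : (1 - n%:R^-1) ^+ k n / (N n)%:R ^+ k n = expR ((k n)%:R * (ln 2 - 2 * ln n%:R)) :> R.
  rewrite -exprVn -exprMn expRM_natl; congr (_ ^+ _).
  have -> : 2 * ln n%:R = ln (n%:R * n%:R) :> R by rewrite lnM ?posrE //; ring.
  rewrite -ln_div ?posrE ?mulr_gt0 // lnK ?posrE ?divr_gt0 ?mulr_gt0 //.
  rewrite /N natr_bin2; field.
  have n2R : 2 <= n%:R :> R by rewrite ler_nat.
  by have := N0; rewrite /N natr_bin2 !gt_eqF //; lra.
have -> : P n = 'C(N n, k n)%:R * expR ((k n)%:R * (ln 2 - 2 * ln n%:R))
    * expR (stirling_log R (k n) + ((k n)%:R + 1 / 2) * ln (k n)%:R - (k n)%:R).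
  rewrite -fact_stirling_log; last by rewrite -(ltr0n R).
  rewrite -powE /P. by rewrite -fK; ring.
rewrite lnK' (_ : stirling_log R _ + _ - _ = stirling_log R (k n) +
   (y / 2 - Q - (k n)%:R * (ln 2 - 2 * ln n%:R))); last first.
  by rewrite /y /Q; field.
rewrite expRD expRB expRB.
have e0 x := lt0r_neq0 (@expR_gt0 R x).
have s0 := lt0r_neq0 sq0.
move: (e0 ((k n)%:R * (ln 2 - 2 * ln n%:R))) (e0 (y / 2)) (e0 Q) (e0 E) (e0 (stirling_log R (k n))) s0.
move: (expR _) (expR (y / 2)) (expR Q) (expR E) (expR _) (Num.sqrt _) => u1 u2 u3 u4 u5 u6.
move=> h1 h2 h3 h4 h5 h6.
field.
by rewrite h1 h2 h3 h4 h5 h6.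
Qed.

End Special.
Theorem proposition1 (R : realType) (s S : nat -> nat -> int)
    (hs : is_stirling1 s) (hS : is_stirling2 S) :
  (forall m : nat -> nat,
     (forall n, (m n <= n)%N) ->
     (fun n => n%:R - (m n)%:R : R) =O_\oo (fun n => Num.sqrt (n%:R : R)) ->
     eq_up_to_bigO
       (fun n => `|s n (m n)|%:~R : R)
       (fun n => 'C('C(n, 2), n - m n)%:R * expR (- mu R n (m n)))
       (fun n => (n%:R - (m n)%:R) / n%:R)
     /\
     eq_up_to_bigO
       (fun n => (S n (m n))%:~R : R)
       (fun n => 'C('C(n, 2), n - m n)%:R * expR (- (2 * mu R n (m n))))
       (fun n => (n%:R - (m n)%:R) / n%:R))
  /\
  (forall (t a : R) (m : nat -> nat),
     0 < t -> 0 <= a -> a <= 1 / 2 ->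
     let F := within [set n | (m n)%:R = n%:R - t * n%:R `^ a] \oo in
     asymp_eq F (fun n => `|s n (m n)|%:~R) (binomial_form (2 / 3) t a m)
     /\ asymp_eq F (fun n => (S n (m n))%:~R) (binomial_form (4 / 3) t a m)
     /\ (0 < a ->
         asymp_eq F (binomial_form (2 / 3) t a m) (explicit_form (2 / 3) t a)
         /\ asymp_eq F (binomial_form (4 / 3) t a m) (explicit_form (4 / 3) t a))).
Proof.
split=> [m|t a m t0 a0 a1 F]; first exact: stirling_bigO.
have D1 : 1 <= 1 + t ^+ 2 by rewrite lerDl sqr_ge0.
have FF : Filter F by apply: within_filter.
have near_F : \forall n \near F, (m n <= n)%N /\
    (n%:R - (m n)%:R) ^+ 2 <= (1 + t ^+ 2) * n%:R :> R.
  apply: filterS (special_near m t0 a1) => n [_ le_mn _ kn]; split=> //.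
  by rewrite -natrB //; apply: le_trans kn _; rewrite ler_wpM2r // lerDr.
have approx : F _ := @cvg_within _ _ eventually_filter _ _ (near_stirling_approx D1).
split; [|split].
- rewrite -[2 / 3]mul1r; apply: (asymp_binomial_form t0 a1 (C := 256 * (1 + t ^+ 2))).
  apply: filterS2 near_F approx => n [le_mn Dn] /(_ _ le_mn Dn) [B0 h _].
  rewrite stirling1_esym // natz -pmulrn !mul1r natrB //.
  by split; [rewrite mulr_gt0 ?expR_gt0 | exact: h].
- rewrite (_ : 4 / 3 = 2 * (2 / 3) :> R); last by field.
  apply: (asymp_binomial_form t0 a1 (C := 256 * (1 + t ^+ 2))).
  apply: filterS2 near_F approx => n [le_mn Dn] /(_ _ le_mn Dn) [B0 _ h].
  rewrite (stirling2_hsym hS) // natz -pmulrn natrB //.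
  by split; [rewrite mulr_gt0 ?expR_gt0 | exact: h].
by move=> ap; split; apply: asymp_explicit_form.
Qed.
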